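(* Let $c\geq 1$ and $n$ be integers with $n\geq (2c+3)^2$, and suppose that $n$ is not of the form $(c+1)p$ with $p$ a prime number. Then $$\sum_{M\in \mathcal{N}[n-1-c]}M\equiv 0\pmod{n}.$$
   Context: For a positive integer $n$ and an integer $0\le k\le n-1$, $\mathcal{N}[k]$ denotes the multiset consisting of the $\binom{n-1}{k}$ products of the elements of the $k$-element subsets of $\mathcal{N}=\{1,\ldots,n-1\}$ (one product for each subset, so repeated values are counted with multiplicity; the empty product is $1$). Thus $\sum_{M\in\mathcal{N}[k]}M=\sum_{S\subseteq\{1,\ldots,n-1\},\,|S|=k}\ \prod_{m\in S}m$. *)

(* Defs.v *)
From mathcomp Require Import all_boot.

Set Implicit Arguments.
Unset Strict Implicit.
Unset Printing Implicit Defensive.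

(* {1, ..., n-1}, as a subset of 'I_n = {0, ..., n-1}. *)
Definition calN (n : nat) : {set 'I_n} := [set i : 'I_n | 0 < i].

(* The multiset N[k] is a sequence with one entry per k-element subset A, so
   equal products are kept with multiplicity; its order is irrelevant. *)
Definition subset_products (n k : nat) : seq nat :=
  [seq \prod_(m in A) val m
     | A : {set 'I_n} <- enum [set A : {set 'I_n} |
         (A \subset calN n) && (#|A| == k)]].

(* Main.v *)
Require Import Defs.
From mathcomp Require Import all_boot all_algebra all_field.
From mathcomp Require Import zify.

(** The sum is the coefficient of [X^(c+1)] in [X (X+1) ... (X+n-1)].  Let
    [p^a] be a prime power exactly dividing [n = m p].  Omitting
    [c+1] of the [m] multiples of [p] in [{0, ..., n-1}] leaves at least
    [m-1-c] of them in each product, which suffices when [2c+3 <= m].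
    Otherwise [m < 2c+3 < p], so [a = 1].  If [c+2 <= m] one multiple of [p]
    remains in each product; [m = c+1] is excluded; and if [m <= c], then modulo
    [p] the polynomial is [(X^p - X)^m], whose exponents are
    [m + j (p-1)], while [m < c+1 < m+p-1]. *)

Lemma sum_subset_products n k :
  \sum_(M <- subset_products n k) M =
  \sum_(A : {set 'I_n} | #|A| == k) \prod_(i in A) val i.
Proof.
rewrite /subset_products big_map big_enum /=.
rewrite [RHS](bigID (fun A : {set 'I_n} => A \subset calN n)) /=.
rewrite [X in _ = _ + X]big1 ?addn0.
  by apply: eq_bigl => A; rewrite inE andbC.
move=> A /andP[_ /subsetPn[i iA]]; rewrite inE -eqn0Ngt => /eqP i0.
by rewrite (bigD1 i) //= i0 mul0n.
Qed.

Lemma card_multiples p m : 0 < p -> #|[set i : 'I_(m * p) | p %| i]| = m.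
Proof.
move=> p0.
have ltf (i : 'I_m) : i * p < m * p by rewrite ltn_pmul2r.
pose f i := Ordinal (ltf i).
have fI : injective f.
  by move=> i j /(congr1 val) /= /eqP; rewrite eqn_pmul2r // => /eqP/val_inj.
rewrite -[RHS]card_ord -cardsT -(card_imset _ fI); apply: eq_card => i.
rewrite inE; apply/idP/imsetP => [/dvdnP[q iq]|[j _ ->]]; last exact: dvdn_mull.
have qm : q < m by have := ltn_ord i; rewrite iq ltn_pmul2r.
by exists (Ordinal qm) => //; apply: val_inj.
Qed.

Lemma expn_dvd_prod_set p m (A : {set 'I_(m * p)}) :
  0 < p -> p ^ (m - #|~: A|) %| \prod_(i in A) val i.
Proof.
move=> p0; pose B := [set i : 'I_(m * p) | p %| i].
have leAB : m - #|~: A| <= #|A :&: B|.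
  rewrite leq_subLR -[X in X <= _](card_multiples p m p0) -/B -(cardsID A B) setIC addnC.
  by rewrite leq_add2r subset_leq_card // setDE subsetIr.
apply: (dvdn_trans (dvdn_exp2l p leAB)).
rewrite (big_setID B) /= dvdn_mulr // -prod_nat_const.
elim/big_ind2: _ => // [x1 x2 y1 y2|i]; first exact: dvdn_mul.
by rewrite !inE => /andP[].
Qed.

(** Applied with [a.-1] the exponent of a prime in [m]. The bound [5 <= m] settles [a = 3], where
    [m = 4] would fail; from [a = 4] on the power of 2 dominates. *)
Lemma double_leq_of_expn_leq a m : 5 <= m -> 2 ^ a.-1 <= m -> a.*2 <= m.+1.
Proof.
move=> m5; case: (leqP a 3) => [|a4 am]; first lia.
suff : a.*2 <= (2 ^ a.-1).+1 by lia.
rewrite -(subnK a4); elim: (a - 4) => // b IHb.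
have -> : (b.+1 + 4).-1 = (b + 4).-1.+1 by lia.
rewrite expnS; lia.
Qed.

Import GRing.Theory.
Local Open Scope ring_scope.

(** When the product is expanded, [A] collects the factors that contribute their constant term; the
    other [n - k] contribute ['X]. *)
Lemma coef_rising_factorial (R : comNzRingType) n k : (k <= n)%N ->
  (\prod_(i < n) ((i%:R)%:P + 'X) : {poly R})`_(n - k) =
  (\sum_(A : {set 'I_n} | #|A| == k) \prod_(i in A) val i)%N%:R.
Proof.
move=> kn; rewrite bigA_distr coef_sum natr_sum [RHS]big_mkcond /=.
apply: eq_bigr => A _.
rewrite (bigID (mem A)) /=.
rewrite (eq_bigr (fun i : 'I_n => (i%:R)%:P : {poly R})); last by move=> i ->.
rewrite [X in _ * X](eq_bigr (fun=> 'X)); last by move=> i /negbTE ->.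
rewrite -rmorph_prod prodr_const coefCM coefXn -natr_prod.
have cA : (#|A| + #|[pred i | i \notin A]| = n)%N.
  by rewrite -[RHS]card_ord -(cardC (mem A)); congr addn; apply: eq_card.
rewrite (_ : (n - k == #|[pred i | i \notin A]|)%N = (#|A| == k)); last by lia.
by case: ifP; rewrite ?mulr1 ?mulr0.
Qed.

(** Each block of [p] consecutive integers runs through ['F_p], and the product of ['X + x] over all
    [x] in the field is ['X^p - 'X]. *)
Lemma rising_factorial_Fp p m : prime p ->
  \prod_(i < m * p) ((i%:R)%:P + 'X) = ('X^p - 'X) ^+ m :> {poly 'F_p}.
Proof.
move=> pp; rewrite -(big_mkord xpredT (fun i => (i%:R)%:P + 'X)).
elim: m => [|m IHm]; first by rewrite mul0n big_geq.
rewrite (@big_cat_nat _ _ _ (m * p)) //= ?leq_mul2r ?leqnSn ?orbT //.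
rewrite IHm exprSr; congr (_ * _).
rewrite -{1}[(m * p)%N]add0n big_addn mulSn addnK.
rewrite (eq_bigr (fun i => (i%:R)%:P + 'X)); last first.
  by move=> i _; rewrite natrD natrM [p%:R]pchar_Fp_0 // mulr0 addr0.
rewrite -[k in index_iota _ k](Fp_cast pp) big_mkord.
rewrite -[k in 'X^k](card_Fp pp) finField_genPoly.
(* Negating the index matches the factors ['X + x] with the factors ['X - x] of
   [finField_genPoly]. *)
rewrite (reindex_inj (@oppr_inj 'F_p)).
by apply: eq_bigr => i _; rewrite (natr_Zp (- i)) polyCN addrC.
Qed.

Lemma coef_XnsubX_exp (R : comNzRingType) p m k : (m < k)%N -> (k < m + p.-1)%N ->
  (('X^p - 'X) ^+ m : {poly R})`_k = 0.
Proof.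
case: p => [|p] mk kmp; first by lia.
rewrite exprS -[X in 'X * _ - X]mulr1 -mulrBr exprMn coefXnM ltnNge ltnW //=.
rewrite exprBn coef_sum big1 // => i _.
(* With ['X^m] factored out, only exponents divisible by [p], now the predecessor of the original
   exponent, occur, while [0 < k - m < p]. *)
have /negbTE ki : (k - m != p * (m - i))%N.
  by apply/eqP; case: (m - i)%N => [|j]; nia.
rewrite expr1n mulr1 -exprM coefMn -signr_odd mulr_sign.
by case: ifP => _; rewrite ?coefN coefXn ki ?oppr0 mul0rn.
Qed.

Lemma dvdn_sum_prod_sets p m c : prime p -> (m <= c)%N -> (c.+1 < p)%N ->
  (0 < m)%N ->
  (p %| \sum_(A : {set 'I_(m * p)} | #|A| == m * p - c.+1) \prod_(i in A) val i)%N.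
Proof.
move=> pp mc cp m0; have cmp : (c.+1 <= m * p)%N by nia.
rewrite (dvdn_pcharf (pchar_Fp pp)) -coef_rising_factorial ?leq_subr //.
by rewrite rising_factorial_Fp // subKn // coef_XnsubX_exp //; lia.
Qed.

Local Close Scope ring_scope.

Theorem theorem4p1 (c n : nat) (hc : 1 <= c) (hn : (2 * c + 3) ^ 2 <= n)
    (hnp : ~ (exists p : nat, prime p /\ n = (c + 1) * p)) :
  \sum_(M <- subset_products n (n - 1 - c)) M = 0 %[mod n].
Proof.
have n0 : 0 < n by nia.
apply/eqP; rewrite mod0n; apply/(dvdn_partP _ n0) => p.
rewrite mem_primes p_part => /and3P[pp _ /dvdnP[m nE]].
rewrite sum_subset_products -subnDA add1n.
have cn : c < n by nia.
move: hn hnp n0 cn; rewrite {n}nE => hn hnp n0 cn.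
have p0 := prime_gt0 pp.
have m0 : 0 < m by case: (m) n0.
set a := logn p _.
have few_omitted : a + c.+1 <= m ->
    p ^ a %| \sum_(A : {set 'I_(m * p)} | #|A| == m * p - c.+1) \prod_(i in A) val i.
  move=> am; apply: dvdn_sum => A /eqP cA.
  apply: dvdn_trans (expn_dvd_prod_set p m A p0); apply: dvdn_exp2l.
  (* As [c < m * p], the subtraction is not truncated and [~: A] has exactly [c.+1] elements. *)
  have : #|A| + #|~: A| = m * p by rewrite cardsC card_ord.
  lia.
have aE : a = (logn p m).+1 by rewrite /a lognM // (logn_prime p pp) eqxx addn1.
case: (leqP (2 * c + 3) m) => [m_ge|m_lt].
  apply: few_omitted.
  (* Adding [2 * c + 3 <= m] to this bound gives [2 * (a + c + 1) <= 2 * m]. *)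
  suff : a.*2 <= m.+1 by lia.
  apply: double_leq_of_expn_leq; first lia.
  rewrite aE /=; apply: leq_trans (dvdn_leq m0 (pfactor_dvdnn p m)).
  by case: (logn p m) => [|b] //; rewrite leq_exp2r // prime_gt1.
(* Here [m <= 2 * c + 2], while [m * p] is at least [(2 * c + 3) ^ 2]. *)
have p_gt : 2 * c + 3 < p by nia.
have a1 : a = 1.
  by rewrite aE lognE pp m0 /=; case: ifP => // /(dvdn_leq m0); lia.
case: (ltngtP m c.+1) => [m_le|m_ge|m_eq].
- by rewrite a1 expn1 dvdn_sum_prod_sets //; lia.
- by apply: few_omitted; lia.
- by case: hnp; exists p; split=> //; rewrite m_eq addn1.
Qed.
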